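(* For all $n\geq 1$, the number of desarrangements of length $n$ avoiding each of $123$, $132$, and $213$ is $d_n(123,132,213)=f_{n-1}$, the $(n-1)$st Fibonacci number.
   Context: Permutations are in one-line notation. An index $i\in[n-1]$ is a descent of $\pi\in\mathfrak{S}_n$ if $\pi_i>\pi_{i+1}$; $i\in[n]$ is an ascent if it is not a descent (so $n$ is always an ascent). A desarrangement is a permutation whose first ascent is even. $d_n(\Pi)$ is the number of desarrangements in $\mathfrak{S}_n$ avoiding every pattern in $\Pi$ ($\pi$ avoids $\sigma$ if no subsequence of $\pi$ has the same relative order as $\sigma$). Fibonacci numbers: $f_0=0$, $f_1=1$, $f_n=f_{n-1}+f_{n-2}$ for $n\ge2$. *)

(* Defs.v *)
From mathcomp Require Import all_boot all_fingroup.

Set Implicit Arguments.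
Unset Strict Implicit.
Unset Printing Implicit Defensive.

(* Positions and values are 0-based: the ordinal [i : 'I_n] stands for the
   index [i.+1] of the one-line notation. *)

Section Desarrangements.

Variable n : nat.
Implicit Types (s : 'S_n) (i : 'I_n).

(* No [j : 'I_n] has value [i.+1] when [i] is the last position, so the last
   position is never a descent. *)
Definition descent s i : bool :=
  [exists j : 'I_n, (nat_of_ord j == i.+1) && (s j < s i)].

Definition ascent s i : bool := ~~ descent s i.

Definition first_ascent s i : bool :=
  ascent s i && [forall j : 'I_n, (j < i) ==> ~~ ascent s j].

(* The parity is that of the 1-based index [i.+1]. *)
Definition desarrangement s : bool :=
  [exists i : 'I_n, first_ascent s i && ~~ odd i.+1].

(* A pattern is given by its one-line word, e.g. [:: 1; 3; 2]. *)
Definition contains s (p : seq nat) : bool :=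
  [exists f : {ffun 'I_(size p) -> 'I_n},
     [forall a : 'I_(size p), forall b : 'I_(size p),
        (a < b) ==> (f a < f b)] &&
     [forall a : 'I_(size p), forall b : 'I_(size p),
        (s (f a) < s (f b)) == (nth 0 p a < nth 0 p b)]].

Definition avoids s (p : seq nat) : bool := ~~ contains s p.

End Desarrangements.

Definition num_desarr (n : nat) (Pi : seq (seq nat)) : nat :=
  #|[set s : 'S_n | desarrangement s && all (avoids s) Pi]|.

Fixpoint fib (n : nat) : nat :=
  match n with
  | 0 => 0
  | 1 => 1
  | (m.+1 as m').+1 => fib m' + fib m
  end.

(* Main.v *)
(* Avoiding 123, 132 and 213 at once means that [s k < s i] whenever
   [i + 1 < k].  Such a permutation of length [m + 2] starts either with its
   maximum, followed by an arbitrary avoider of length [m + 1], or with its two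
   largest values in increasing order, followed by an arbitrary avoider of
   length [m]; hence the avoiders satisfy the Fibonacci recurrence.  The first
   kind shifts the first ascent by one, so it is a desarrangement iff the tail
   is not; the second kind has its first ascent at position 1 and is never a
   desarrangement.  So [d_(m+2) + d_(m+1)] is the number of avoiders of length
   [m + 1]. *)
Require Import Defs.
From mathcomp Require Import all_boot all_fingroup.
From mathcomp Require Import zify.

Set Implicit Arguments.
Unset Strict Implicit.
Unset Printing Implicit Defensive.

(** * The three patterns as a single condition on distant positions *)

Definition far_decreasing n (s : 'S_n) : bool :=
  [forall i : 'I_n, forall k : 'I_n, (i.+1 < k) ==> (s k < s i)].

Lemma far_decreasingP n (s : 'S_n) :
  reflect (forall i k : 'I_n, i.+1 < k -> s k < s i) (far_decreasing s).
Proof.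
apply: (iffP forallP) => [H i k ik | H i].
  by have /forallP/(_ k)/implyP := H i; apply.
by apply/forallP => k; apply/implyP; apply: H.
Qed.

(** Of the nine comparisons in [contains], the three diagonal ones hold by irreflexivity; the other
    six are kept as equations, so that [lia] can decide them for a concrete pattern. *)
Lemma contains3P n (s : 'S_n) (x y z : nat) :
  reflect (exists i j k : 'I_n, [/\ i < j, j < k,
      [/\ (s i < s j) = (x < y), (s i < s k) = (x < z) & (s j < s k) = (y < z)]
    & [/\ (s j < s i) = (y < x), (s k < s i) = (z < x) & (s k < s j) = (z < y)]])
    (contains s [:: x; y; z]).
Proof.
apply: (iffP existsP) => [[f /andP[/forallP inc /forallP ord]] | [i [j [k H]]]].
  have inc' (a b : 'I_3) : a < b -> f a < f b.
    by have /forallP/(_ b)/implyP := inc a.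
  have ord' (a b : 'I_3) : (s (f a) < s (f b))
      = (nth 0 [:: x; y; z] a < nth 0 [:: x; y; z] b).
    by have /forallP/(_ b)/eqP := ord a.
  pose o0 : 'I_3 := @Ordinal 3 0 isT; pose o1 : 'I_3 := @Ordinal 3 1 isT.
  pose o2 : 'I_3 := @Ordinal 3 2 isT.
  exists (f o0), (f o1), (f o2).
  by split; [exact: inc' | exact: inc' | split | split]; rewrite ord'.
case: H => ij jk [e1 e2 e3] [e4 e5 e6].
exists [ffun a : 'I_3 => nth i [:: i; j; k] a].
have ik := ltn_trans ij jk.
apply/andP; split; apply/forallP => a; apply/forallP => b; rewrite !ffunE.
  by apply/implyP; case: a b => [[|[|[|?]]] ?] [[|[|[|?]]] ?].
by case: a b => [[|[|[|?]]] ?] [[|[|[|?]]] ?] //=;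
  rewrite ?ltnn // ?e1 ?e2 ?e3 ?e4 ?e5 ?e6.
Qed.

(** If [i.+1 < k] but [s i < s k], the position just after [i] lies strictly between them, and
    wherever its value falls, one of the three patterns appears. Conversely, each pattern has its
    first entry below its last, at positions at least two apart. *)
Lemma avoids_far_decreasing n (s : 'S_n) :
  all (avoids s) [:: [:: 1; 2; 3]; [:: 1; 3; 2]; [:: 2; 1; 3]]
    = far_decreasing s.
Proof.
apply/idP/far_decreasingP => [/and4P[a123 a132 a213 _] i k ik | H].
  have jn : i.+1 < n by apply: ltn_trans ik (ltn_ord k).
  pose j := Ordinal jn.
  have inj (a b : 'I_n) : nat_of_ord a != b -> nat_of_ord (s a) != s b.
    by move=> ab; rewrite val_eqE (inj_eq perm_inj) -val_eqE.
  have ij : s i != s j :> nat by apply: inj => /=; lia.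
  have jk : s j != s k :> nat by apply: inj => /=; lia.
  have ik' : s i != s k :> nat by apply: inj => /=; lia.
  case: (ltnP (s k) (s i)) => // ski.
  have [sij | sij] := ltnP (s i) (s j).
    have [sjk | sjk] := ltnP (s j) (s k).
      case/negP: a123; apply/contains3P; exists i, j, k.
      by split=> //; split; lia.
    case/negP: a132; apply/contains3P; exists i, j, k.
    by split=> //; split; lia.
  case/negP: a213; apply/contains3P; exists i, j, k.
  by split=> //; split; lia.
rewrite /= /avoids andbT; apply/and3P.
by split; apply/contains3P => -[i [j [k [ij jk [e1 e2 e3] [e4 e5 e6]]]]];
  have := H i k; lia.
Qed.

(** * Prepending one or two large values *)

Lemma lift_perm_surj n (i j : 'I_n.+1) (s : 'S_n.+1) :
  s i = j -> exists t : 'S_n, s = lift_perm i j t.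
Proof.
move=> sij.
have sl k : exists l, s (lift i k) = lift j l.
  case: (unliftP j (s (lift i k))) => [l ->|e]; first by exists l.
  by have := neq_lift i k; rewrite -(inj_eq (@perm_inj _ s)) sij e eqxx.
(* The default [k] is never taken: by [sl], [s (lift i k)] always differs from [j]. *)
pose f k := odflt k (unlift j (s (lift i k))).
have fE k : s (lift i k) = lift j (f k).
  by case: (sl k) => l e; rewrite /f e liftK.
have f_inj : injective f.
  by move=> a b e; apply: (@lift_inj _ i); apply: (@perm_inj _ s); rewrite !fE e.
exists (perm f_inj); apply/permP => k.
case: (unliftP i k) => [l ->|->]; last by rewrite lift_perm_id.
by rewrite lift_perm_lift permE.
Qed.

Definition cons_max n (t : 'S_n) : 'S_n.+1 := lift_perm ord0 ord_max t.

Lemma cons_max0 n (t : 'S_n) : cons_max t ord0 = ord_max.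
Proof. exact: lift_perm_id. Qed.

Lemma cons_max_lift n (t : 'S_n) i : cons_max t (lift ord0 i) = t i :> nat.
Proof. by rewrite lift_perm_lift lift_max. Qed.

(** Inserting the value [n] in front pushes the leading [n] of [cons_max t] up to [n.+1] and leaves
    the smaller values alone, so the word starts with [n], [n.+1]. *)
Definition cons_max2 n (t : 'S_n) : 'S_n.+2 :=
  lift_perm ord0 (inord n) (cons_max t).

Lemma cons_max2_0 n (t : 'S_n) : cons_max2 t ord0 = n :> nat.
Proof. by rewrite lift_perm_id inordK. Qed.

Lemma cons_max2_1 n (t : 'S_n) : cons_max2 t (lift ord0 ord0) = n.+1 :> nat.
Proof. by rewrite lift_perm_lift cons_max0 /= inordK // /bump leqnn. Qed.

Lemma cons_max2_lift n (t : 'S_n) i :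
  cons_max2 t (lift ord0 (lift ord0 i)) = t i :> nat.
Proof.
rewrite lift_perm_lift /= inordK // -/(cons_max t) cons_max_lift /bump.
by have := ltn_ord (t i); lia.
Qed.

Lemma lift_perm_inj n (i j : 'I_n.+1) : injective (lift_perm i j).
Proof.
move=> s t /permP e; apply/permP => k; apply: (@lift_inj _ j).
by have := e (lift i k); rewrite !lift_perm_lift.
Qed.

Lemma cons_max_inj n : injective (@cons_max n).
Proof. exact: lift_perm_inj. Qed.

Lemma cons_max2_inj n : injective (@cons_max2 n).
Proof. by move=> s t /lift_perm_inj/cons_max_inj. Qed.

Lemma far_decreasing_cons_max n (t : 'S_n) :
  far_decreasing (cons_max t) = far_decreasing t.
Proof.
apply/far_decreasingP/far_decreasingP => H i k ik.
  by rewrite -(cons_max_lift t i) -(cons_max_lift t k); apply: H.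
case: (unliftP ord0 k) ik => [k' ->|->] // ik; rewrite cons_max_lift.
case: (unliftP ord0 i) ik => [i' ->|->] ik; last by rewrite cons_max0 /=.
by rewrite cons_max_lift; apply: H.
Qed.

(** The two leading entries increase but are adjacent, hence unconstrained, and both exceed every
    value of [t]. *)
Lemma far_decreasing_cons_max2 n (t : 'S_n) :
  far_decreasing (cons_max2 t) = far_decreasing t.
Proof.
apply/far_decreasingP/far_decreasingP => H i k ik.
  by rewrite -(cons_max2_lift t i) -(cons_max2_lift t k); apply: H.
case: (unliftP ord0 k) ik => [k1 ->|->] // ik.
case: (unliftP ord0 k1) ik => [k' ->|->] // ik; rewrite cons_max2_lift.
case: (unliftP ord0 i) ik => [i1 ->|->] ik; last by rewrite cons_max2_0.
case: (unliftP ord0 i1) ik => [i' ->|->] ik; last first.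
  by rewrite cons_max2_1; apply: ltnW; rewrite ltnS.
by rewrite cons_max2_lift; apply: H.
Qed.

(* The maximum sits at one of the first two positions; if it is the second one,
   the value just below it can only be the first entry. *)
Lemma far_decreasing_shape n (s : 'S_n.+2) : far_decreasing s ->
  (exists t, s = cons_max t) \/ (exists t, s = cons_max2 t).
Proof.
move/far_decreasingP => H.
pose p v := (s^-1)%g v.
have sp v : s (p v) = v by rewrite /p permKV.
have pmax : p ord_max <= 1.
  rewrite leqNgt; apply/negP => /(H ord0); rewrite sp /=.
  by have := ltn_ord (s ord0); lia.
have [s0 | s0] := eqVneq (s ord0) ord_max.
  by left; apply: lift_perm_surj.
have p1 : p ord_max = lift ord0 ord0.
  apply: val_inj => /=; rewrite /bump /=.
  suff : nat_of_ord (p ord_max) != 0 by lia.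
  apply: contraNneq s0 => e.
  by rewrite -[X in _ == X](sp ord_max); apply/eqP; congr (s _); apply: val_inj.
have s1 : s (lift ord0 ord0) = ord_max by rewrite -p1 sp.
have p0 : p (inord n) = ord0.
  have : nat_of_ord (p (inord n)) != 1.
    apply/eqP => e; have e1 : p (inord n) = lift ord0 ord0 by apply: val_inj.
    have := sp (inord n); rewrite e1 s1 => /(congr1 val) /=.
    by rewrite inordK //; lia.
  (* If the value [n] came after position 1, then [s ord0] would exceed [n] and be the maximum,
     against [s0]. *)
  move=> ne1; apply: val_inj => /=; apply/eqP; rewrite -leqn0 leqNgt.
  apply/negP => gt0.
  have := H ord0 (p (inord n)); rewrite sp inordK //= => /(_ _).
  have := ltn_ord (s ord0); have : nat_of_ord (s ord0) != n.+1.
    by rewrite -val_eqE /= in s0.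
  by lia.
have sn : s ord0 = inord n by rewrite -p0 sp.
have [t' st'] := lift_perm_surj sn.
(* Peel a second entry: only a value at least [n] is lifted past [n] to [n.+1], so [s1] forces
   [t' ord0] to be the maximum. *)
right; have [|t t'E] := @lift_perm_surj _ ord0 ord_max t'.
  have := congr1 val s1; rewrite st' lift_perm_lift /= inordK // /bump => e.
  by apply: val_inj => /=; have := ltn_ord (t' ord0); lia.
by exists t; rewrite st' t'E.
Qed.

(** * Counting the avoiders *)

Definition far_dec_perms n := [set s : 'S_n | far_decreasing s].

Lemma far_dec_perms_rec n : far_dec_perms n.+2 =
  (@cons_max n.+1 @: far_dec_perms n.+1) :|: (@cons_max2 n @: far_dec_perms n).
Proof.
apply/setP => s; rewrite !inE; apply/idP/orP => [sd | ].
  have [[t st] | [t st]] := far_decreasing_shape sd; [left | right];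
    apply/imsetP; exists t => //; rewrite inE.
    by rewrite -far_decreasing_cons_max -st.
  by rewrite -far_decreasing_cons_max2 -st.
case=> /imsetP[t]; rewrite inE => td ->.
  by rewrite far_decreasing_cons_max.
by rewrite far_decreasing_cons_max2.
Qed.

Lemma cons_max_neq_max2 n (t : 'S_n.+1) (u : 'S_n) : cons_max t != cons_max2 u.
Proof.
apply/eqP => e; have := cons_max2_0 u.
by rewrite -e cons_max0 /=; lia.
Qed.

Lemma card_far_dec_perms n : #|far_dec_perms n| = fib n.+1.
Proof.
(* The recurrence reaches back two lengths, so the induction carries two consecutive counts. *)
suff: #|far_dec_perms n| = fib n.+1 /\ #|far_dec_perms n.+1| = fib n.+2.
  by case.
elim: n => [|n [IH0 IH1]].
  split.
    have -> : far_dec_perms 0 = setT.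
      by apply/setP => s; rewrite !inE; apply/far_decreasingP => -[].
    by rewrite cardsT card_Sn.
  have -> : far_dec_perms 1 = setT.
    by apply/setP => s; rewrite !inE; apply/far_decreasingP => i k; rewrite !ord1.
  by rewrite cardsT card_Sn.
split=> //; rewrite far_dec_perms_rec cardsU.
rewrite !card_imset; [|exact: cons_max2_inj|exact: cons_max_inj].
rewrite (_ : _ :&: _ = set0) ?cards0 ?subn0 ?IH0 ?IH1 //.
apply/setP => s; rewrite !inE; apply/negP => /andP[/imsetP[t _ ->] /imsetP[u _]].
by apply/eqP/cons_max_neq_max2.
Qed.

(** * First ascents and parity *)

Lemma descent_cons_max0 n (t : 'S_n.+1) : descent (cons_max t) ord0.
Proof.
apply/existsP; exists (lift ord0 ord0).
by rewrite cons_max_lift cons_max0 /= ltn_ord.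
Qed.

Lemma descent_cons_max n (t : 'S_n) i :
  descent (cons_max t) (lift ord0 i) = descent t i.
Proof.
apply/existsP/existsP => -[j /andP[/eqP ji lt]].
  case: (unliftP ord0 j) ji lt => [j' ->|->] // ji.
  rewrite !cons_max_lift => lt; exists j'; rewrite lt andbT.
  by move: ji; rewrite /= /bump; lia.
exists (lift ord0 j); rewrite !cons_max_lift lt andbT.
by rewrite /= /bump; lia.
Qed.

(** The new front position is a descent, since [t] is nonempty, and all later descents just move by
    one. *)
Lemma first_ascent_cons_max n (t : 'S_n.+1) i :
  first_ascent (cons_max t) (lift ord0 i) = first_ascent t i.
Proof.
rewrite /first_ascent /ascent descent_cons_max; congr (_ && _).
apply/forallP/forallP => H j; apply/implyP => ji.
  have /implyP := H (lift ord0 j); rewrite descent_cons_max; apply.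
  by rewrite /= /bump; lia.
case: (unliftP ord0 j) ji => [j' ->|->] ji; last by rewrite descent_cons_max0.
rewrite descent_cons_max; apply: (implyP (H j')).
by move: ji; rewrite /= /bump; lia.
Qed.

Lemma first_ascent_uniq n (s : 'S_n) i j :
  first_ascent s i -> first_ascent s j -> i = j.
Proof.
move=> /andP[ai /forallP mi] /andP[aj /forallP mj]; apply: val_inj => /=.
case: (ltngtP i j) => // ij.
  by have := mj i; rewrite ij ai.
by have := mi j; rewrite ij aj.
Qed.

(** The last position is always an ascent, so a least one exists. *)
Lemma first_ascent_exists n (s : 'S_n.+1) : exists i, first_ascent s i.
Proof.
have amax : ascent s ord_max.
  by apply/existsP => -[j /andP[/eqP e _]]; have := ltn_ord j; rewrite e ltnn.
case: (arg_minnP (fun i : 'I_n.+1 => nat_of_ord i) amax) => i ai mi.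
exists i; rewrite /first_ascent ai; apply/forallP => j; apply/implyP => ji.
by apply: contraL ji => /mi; rewrite leqNgt.
Qed.

(** Uniqueness of the first ascent turns the existential into a parity test; the 1-based index
    [i.+1] is even when [i] is odd. *)
Lemma desarrangementE n (s : 'S_n) i :
  first_ascent s i -> desarrangement s = odd i.
Proof.
move=> si; apply/existsP/idP => [[j /andP[sj]] | oi].
  by rewrite (first_ascent_uniq sj si) /= negbK.
by exists i; rewrite si /= negbK.
Qed.

Lemma desarrangement_cons_max n (t : 'S_n.+1) :
  desarrangement (cons_max t) = ~~ desarrangement t.
Proof.
have [i ti] := first_ascent_exists t.
rewrite (desarrangementE ti).
have := ti; rewrite -first_ascent_cons_max => /desarrangementE ->.
by rewrite /= /bump /=.
Qed.

Lemma desarrangement_cons_max2 n (t : 'S_n) :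
  desarrangement (cons_max2 t) = false.
Proof.
suff /desarrangementE -> : first_ascent (cons_max2 t) ord0 by [].
apply/andP; split; last by apply/forallP.
apply/existsP => -[j /andP[/eqP j1]].
have -> : j = lift ord0 ord0 by apply: val_inj.
by rewrite cons_max2_0 cons_max2_1; lia.
Qed.

(** * Counting the desarrangements *)

Definition far_dec_desarr n := [set s in far_dec_perms n | desarrangement s].

Lemma far_dec_desarr_rec n : far_dec_desarr n.+2 =
  @cons_max n.+1 @: (far_dec_perms n.+1 :\: far_dec_desarr n.+1).
Proof.
apply/setP => s; apply/setIdP/imsetP => [[] | [t]].
  rewrite far_dec_perms_rec => /setUP[] /imsetP[t td ->].
    rewrite desarrangement_cons_max => nd; exists t => //.
    by rewrite inE td [t \in _]inE td nd.
  by rewrite desarrangement_cons_max2.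
rewrite !inE => /andP[nd td] ->.
by rewrite far_decreasing_cons_max desarrangement_cons_max td; rewrite td in nd.
Qed.

Lemma card_far_dec_desarr n : #|far_dec_desarr n.+1| = fib n.
Proof.
elim: n => [|n IHn].
  apply/eqP; rewrite cards_eq0; apply/eqP/setP => s; rewrite !inE.
  have [i si] := first_ascent_exists s.
  (* In length 1 the first ascent is at position 0, which is not odd. *)
  by rewrite (desarrangementE si) (ord1 i) andbF.
rewrite far_dec_desarr_rec card_imset; last exact: cons_max_inj.
(* The complement has [fib n.+2 - fib n] elements, which is [fib n.+1]. *)
rewrite cardsD (setIidPr _) ?card_far_dec_perms ?IHn; first by rewrite /= addnK.
by apply/subsetP => s /setIdP[].
Qed.

Theorem theorem3p26 (n : nat) (hn : 1 <= n) :
  num_desarr n [:: [:: 1; 2; 3]; [:: 1; 3; 2]; [:: 2; 1; 3]] = fib n.-1.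
Proof.
case: n hn => // n _; rewrite -card_far_dec_desarr; apply: eq_card => s.
by rewrite !inE avoids_far_decreasing andbC.
Qed.
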